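(* Let $q$ be an odd prime power, $g\ge1$, $D\in\mathbb{F}_q[x]$ monic square-free of degree $2g+1$, and let $u_j=q^{-1/2}e(\theta_j)$, $j=1,\dots,2g$, be the zeros of $\mathcal{L}(u,\chi_D)$. Let $K\ge1$ be an integer. Then for every $\theta\in\mathbb{R}$, $$S_K(\theta,\chi_D)=\sum_{j=1}^{2g}\big(-s(\theta-\theta_j)+E_K(\theta-\theta_j)\big)$$ and $$S_K(\theta,\chi_D)=\sum_{j=1}^{2g}\sum_{k=1}^{K}\frac{\sin(2\pi(\theta-\theta_j)k)}{\pi k},$$ where the function $E_K$ satisfies $$|E_K(\theta-\theta_j)|\le\min\Big(\frac12,\frac{1}{4\pi K\|\theta-\theta_j\|}\Big).$$
   Context: $\chi_D(f)=(D/f)$ is the quadratic character (Jacobi symbol) on $\mathbb{F}_q[x]$; $\mathcal{L}(u,\chi_D)=\sum_{f\ \mathrm{monic}}\chi_D(f)u^{\deg f}$, a polynomial of degree $2g$ whose zeros lie on $|u|=q^{-1/2}$. $e(x)=e^{2\pi ix}$, $\|x\|=\min_{n\in\mathbb{Z}}|x-n|$. $\Lambda(f)=\deg P$ if $f=P^n$ with $P$ monic irreducible, $n\ge1$, else $0$. $P_K(u,\chi_D)=\exp\big(\sum_{k=1}^{K}\sum_{f\ \mathrm{monic},\ \deg f=k}\Lambda(f)\chi_D(f)u^k/k\big)$. With $\Gamma(\theta)$ the path consisting of the positively oriented arc from $q^{-2}$ to $q^{-2}e(\theta)$ followed by the radial segment to $q^{-1/2}e(\theta)$, $\arg P_K(q^{-1/2}e(\theta),\chi_D)$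 is minus the continuous change of argument of $P_K(u,\chi_D)$ along $\Gamma(\theta)$ (starting at $0$), and $S_K(\theta,\chi_D)=\frac1\pi\arg P_K(q^{-1/2}e(\theta),\chi_D)$. The function $s$ is $s(x)=\{x\}-\frac12$ for $x\notin\mathbb{Z}$, $s(x)=0$ for $x\in\mathbb{Z}$. $E_K(x)$ denotes $s(x)+\sum_{k=1}^K\frac{\sin(2\pi xk)}{\pi k}$. *)

(* Defs.v *)
From HB Require Import structures.
From mathcomp Require Export all_boot all_order all_algebra.
From mathcomp Require Export complex.
From mathcomp Require Export all_classical all_reals all_analysis.

Set Implicit Arguments.
Unset Strict Implicit.
Unset Printing Implicit Defensive.
Import Order.TTheory GRing.Theory Num.Theory.
Import numFieldNormedType.Exports.
Local Open Scope classical_set_scope.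
Local Open Scope ring_scope.

Section FunctionField.
Variable F : finFieldType.
Implicit Types (D f P : {poly F}) (n k : nat).

Definition squarefree D : Prop :=
  forall p : {poly F}, (p ^+ 2 %| D) -> (size p = 1)%N.

Definition monic_irreducible P : bool := (P \is monic) && irreducibleb P.

Definition legendre D P : int :=
  if P %| D then 0
  else if `[< exists a : {poly F}, P %| a ^+ 2 - D >] then 1 else -1.

(* The range of e suffices because P^e %| f with deg P >= 1 forces
   e <= deg f < size f. *)
Definition multiplicity P f : nat :=
  (\max_(e < size f | (P ^+ e %| f)%R) e)%N.

(* (D/f) for f monic: the product of the (D/P)^e over the prime powers P^e
   exactly dividing f (the primes not dividing f contribute a factor 1). *)
Definition jacobi D f : int :=
  \prod_(P : {poly_(size f) F} | monic_irreducible P)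
     legendre D P ^+ multiplicity P f.

(* When f is not a prime power, xget returns 1, whose degree is 0. *)
Definition Lambda f : nat :=
  (size (xget 1%R [set P : {poly F} |
     monic_irreducible P /\ exists n, (0 < n)%N /\ f = (P ^+ n)%R])).-1.

Definition monic_deg n f : bool := (f \is monic) && (size f == n.+1).

End FunctionField.

Section Analysis.
Variable R : realType.
Local Notation C := R[i].
Implicit Types (x t theta : R) (K : nat).

Definition cis x : C := (cos x +i* sin x)%C.

Definition e_ x : C := cis (2 * pi * x).

Definition cexp (z : C) : C :=
  ((expR (complex.Re z))%:C)%C * cis (complex.Im z).

Definition dist_int x : R := inf [set `|x - n%:~R| | n in [set: int]].

Definition fracpart x : R := x - (Num.floor x)%:~R.

Definition saw x : R := if x \is a Num.int then 0 else fracpart x - 2^-1.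

Definition E_ K x : R :=
  saw x + \sum_(1 <= k < K.+1) sin (2 * pi * x * k%:R) / (pi * k%:R).

(* The continuous change of argument of w on [a, b]: phi b - phi a for any
   continuous determination phi of the argument of w. *)
Definition arg_change (a b : R) (w : R -> C) : R :=
  get [set c : R | exists phi : R -> R,
    [/\ {within `[a, b], continuous phi},
        {in `[a, b], forall t, w t = `|w t| * cis (phi t)}
      & c = phi b - phi a]].

End Analysis.

Section LFunction.
Variables (R : realType) (F : finFieldType) (D : {poly F}).
Local Notation C := R[i].
Implicit Types (t theta : R) (n K : nat) (u : C).

Local Notation q := (#|F|%:R : R).

Definition radius : R := (Num.sqrt q)^-1.

Definition circle_pt theta : C := (radius%:C)%C * e_ theta.

Definition L_coef n : int :=
  \sum_(f : {poly_n.+1 F} | monic_deg n f) jacobi D f.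

(* The power series sum over all monic f of chi_D(f) u^(deg f), regarded as
   a polynomial: the unique p with these coefficients.  (The default 0 would
   be returned only if infinitely many coefficients were nonzero.) *)
Definition L_poly : {poly C} :=
  xget 0 [set p : {poly C} | forall n, p`_n = (L_coef n)%:~R].

Definition P_ K u : C :=
  cexp (\sum_(1 <= k < K.+1) \sum_(f : {poly_k.+1 F} | monic_deg k f)
          (Lambda f)%:R * (jacobi D f)%:~R * u ^+ k / k%:R).

(* The positively oriented arc from q^-2 to q^-2 e(theta) is parametrized on
   [0, 1] (it has angle 2 pi {theta}), the radial segment on [1, 2]. *)
Definition Gamma theta t : C :=
  if t <= 1 then ((q ^- 2)%:C)%C * e_ (t * fracpart theta)
  else (((2 - t) * q ^- 2 + (t - 1) * radius)%:C)%C * e_ theta.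

Definition arg_P K theta : R :=
  - arg_change 0 2 (fun t => P_ K (Gamma theta t)).

Definition S_ K theta : R := pi^-1 * arg_P K theta.

End LFunction.

(* Main.v *)
(* Writing a_k for the sum of Lambda(f) chi_D(f) over the monic f of degree k,
   P_K is the exponential of the polynomial sum_{k <= K} a_k u^k / k, so the
   change of its argument along Gamma(theta) is the increment of the imaginary
   part of that polynomial.

   Complete multiplicativity of chi_D and sum_{h | f} Lambda(h) = deg f give
   n c_n = sum_{1 <= k <= n} a_k c_(n-k) for the coefficients c_n of L(u, chi_D).
   Newton's identities for prod_j (1 - u / u_j) are the same recursion with
   - sum_j u_j^(-k) in place of a_k, hence a_k = - sum_j u_j^(-k).

   For 0 < x < 1, pi E_K(x) is the value at v = 1 of
     sum_{k <= K} v^(2k) sin(2 pi k x) / k - arg (1 / (1 - v^2 e(x))),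
   which vanishes at v = 0 and whose derivative is at most v^(2K) / sin(pi x)
   because |1 - v^2 e(x)| >= 2 v sin(pi x).  Hence
   |E_K(x)| <= 1 / ((2K + 1) pi sin(pi x)), and Jordan's inequality
   sin(pi x) >= 2 ||x|| concludes.  The bound 1/2 is elementary when
   (2K + 1) ||x|| <= 1, and follows from the previous one otherwise. *)

Require Import Defs.
From mathcomp Require Import ring lra zify.
Import Order.TTheory GRing.Theory Num.Theory.
Import numFieldNormedType.Exports.
Local Open Scope classical_set_scope.
Local Open Scope ring_scope.
Set Implicit Arguments.
Unset Strict Implicit.
Unset Printing Implicit Defensive.

(** * Prime factorization and the Jacobi symbol *)

Section PolyFactorization.
Variable F : fieldType.
Implicit Types (P f h : {poly F}) (e m : nat).

Lemma irreducible_dvdM P f h :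
  irreducible_poly P -> (P %| f * h) = (P %| f) || (P %| h).
Proof.
move=> irrP; apply/idP/orP=> [|[] ?]; last 2 first.
- exact: dvdp_mulr.
- exact: dvdp_mull.
have [Pf|nPf] := boolP (P %| f); first by left.
by rewrite Gauss_dvdpr ?irreducible_poly_coprime//; right.
Qed.

Lemma irreducible_dvdX P f e : irreducible_poly P -> P %| f ^+ e -> P %| f.
Proof.
move=> irrP; elim: e => [|e IH].
  by rewrite expr0 dvdp1 => /eqP sP; have := irrP.1; rewrite sP.
by rewrite exprS irreducible_dvdM// => /orP[].
Qed.

Lemma monic_irreducible_dvd_eq P f : P \is monic -> f \is monic ->
  irreducible_poly P -> irreducible_poly f -> P %| f -> P = f.
Proof.
move=> mP mf irrP irrf Pf; apply/eqP; rewrite -eqp_monic//.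
by apply: irrf.2 => //; rewrite gtn_eqF// irrP.1.
Qed.

Lemma monic_size_le1 f : f \is monic -> (size f <= 1)%N -> f = 1.
Proof.
move=> mf f1; apply/eqP; rewrite -eqp_monic ?monic1// -size_poly_eq1 eqn_leq f1.
by rewrite size_poly_gt0 monic_neq0.
Qed.

Lemma size_monic_exp P e : P \is monic -> (size (P ^+ e)).-1 = (e * (size P).-1)%N.
Proof. by move=> mP; rewrite size_exp mulnC. Qed.

Lemma exists_monic_irreducible_dvd f : (1 < size f)%N ->
  exists P, [/\ P \is monic, irreducible_poly P & P %| f].
Proof.
have [n] := ubnP (size f); elim: n f => // n IH f fn f1.
have f0 : f != 0 by rewrite -size_poly_gt0; lia.
have [irrf|nirr] := pselect (irreducible_poly f).
  exists ((lead_coef f)^-1 *: f).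
  have lf : (lead_coef f)^-1 != 0 by rewrite invr_eq0 lead_coef_eq0.
  split; last by rewrite dvdpZl.
    by rewrite monicE lead_coefZ mulVf// lead_coef_eq0.
  split; first by rewrite size_scale.
  by move=> r r1; rewrite dvdpZr// => /(irrf.2 _ r1) /eqp_trans; apply;
     rewrite eqp_sym eqp_scale.
have [r [r1 rf nrf]] : exists r : {poly F}, [/\ size r != 1, r %| f & ~~ (r %= f)].
  apply: contrapT => H; apply: nirr; split=> // r r1 rf.
  by apply/negP => /negP nrf; apply: H; exists r.
have r0 : r != 0 by apply: contraNneq f0 => r0; rewrite r0 dvd0p in rf.
have rs : (size r < size f)%N.
  by rewrite ltn_neqAle dvdp_leq// andbT; apply: contraNN nrf; rewrite dvdp_size_eqp.
have [|P [mP iP Pr]] := IH r (leq_trans rs fn).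
  by move: r0; rewrite -size_poly_gt0; move: r1; lia.
by exists P; split=> //; exact: dvdp_trans Pr rf.
Qed.

Lemma dvdp_exp_lt_size P f m : (1 < size P)%N -> f != 0 -> P ^+ m %| f ->
  (m < size f)%N.
Proof.
move=> P1 f0 Pm; have f1 : (0 < size f)%N by rewrite size_poly_gt0.
rewrite -(prednK f1) ltnS (@leq_trans ((size P).-1 * m))//.
  by rewrite leq_pmull//; have := P1; lia.
by rewrite -size_exp -!subn1 leq_sub2r// dvdp_leq.
Qed.

Lemma exists_multiplicity P f : (1 < size P)%N -> f != 0 ->
  exists2 m, P ^+ m %| f & ~~ (P ^+ m.+1 %| f).
Proof.
move=> P1 f0.
have ex0 : exists m, P ^+ m %| f by exists 0%N; rewrite expr0 dvd1p.
have bound m : P ^+ m %| f -> (m <= size f)%N.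
  by move=> Pm; rewrite ltnW// (dvdp_exp_lt_size P1).
case: (ex_maxnP ex0 bound) => m Pm maxm; exists m => //.
by apply/negP => /maxm; rewrite ltnn.
Qed.

Lemma dvdp_exp_multiplicity P f (m e : nat) :
  P ^+ m %| f -> ~~ (P ^+ m.+1 %| f) -> (P ^+ e %| f) = (e <= m)%N.
Proof.
move=> Pm nPm; apply/idP/idP => [Pe|em].
  rewrite leqNgt; apply: contra nPm => me.
  exact: dvdp_trans (dvdp_exp2l _ me) Pe.
exact: dvdp_trans (dvdp_exp2l _ em) Pm.
Qed.

End PolyFactorization.

(** * Multiplicities, multiplicativity of the Jacobi symbol, and the divisor sum of Lambda *)

Section Multiplicity.
Variable F : finFieldType.
Implicit Types (P Q f h D : {poly F}) (e n m : nat).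

Lemma multiplicity_unique P f m : (1 < size P)%N -> f != 0 ->
  P ^+ m %| f -> ~~ (P ^+ m.+1 %| f) -> multiplicity P f = m.
Proof.
move=> P1 f0 Pm nPm; have mult := dvdp_exp_multiplicity _ Pm nPm.
have ms : (m < size f)%N by exact: dvdp_exp_lt_size P1 f0 Pm.
apply/eqP; rewrite eqn_leq; apply/andP; split.
  by apply/bigmax_leqP => i; rewrite mult.
by apply: (bigop.bigmax_sup (Ordinal ms)) => //=; rewrite mult.
Qed.

(** Write f = P^a f' and h = P^b h' with P dividing neither cofactor; as P is prime, it does not
    divide f' h'. *)
Lemma multiplicityM P f h : irreducible_poly P -> f != 0 -> h != 0 ->
  multiplicity P (f * h) = (multiplicity P f + multiplicity P h)%N.
Proof.
move=> irrP f0 h0; have P1 := irrP.1; have P0 := irredp_neq0 irrP.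
have [a Pa nPa] := exists_multiplicity P1 f0.
have [b Pb nPb] := exists_multiplicity P1 h0.
rewrite (multiplicity_unique P1 f0 Pa nPa) (multiplicity_unique P1 h0 Pb nPb).
apply: multiplicity_unique => //; first by rewrite mulf_neq0.
  by rewrite exprD dvdp_mul.
move: Pa nPa Pb nPb => /dvdpP[f' ->] nPa /dvdpP[h' ->] nPb.
have Pn e : P ^+ e != 0 by rewrite expf_neq0.
move: nPa nPb; rewrite !exprS !dvdp_mul2r// => nPa nPb.
by rewrite exprD mulrACA dvdp_mul2r ?mulf_neq0// irreducible_dvdM// negb_or nPa.
Qed.

Lemma multiplicity_ndvd P f : (1 < size P)%N -> f != 0 -> ~~ (P %| f) ->
  multiplicity P f = 0%N.
Proof.
by move=> P1 f0 nPf; apply: multiplicity_unique; rewrite ?expr0 ?dvd1p ?expr1.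
Qed.

Lemma monic_irreducibleP P :
  reflect (P \is monic /\ irreducible_poly P) (monic_irreducible P).
Proof. by apply: (iffP andP) => -[mP /irreducibleP]. Qed.

(** The finite types [{poly_n F}] in the definitions have bounds that vary with the polynomial or
    the degree; this brings such sums and products to a common bound. *)
Lemma big_npoly_widen (T : Type) (idx : T) (op : Monoid.com_law idx)
    n N (p : pred {poly F}) (G : {poly F} -> T) :
  (n <= N)%N -> (forall f, p f -> (size f <= N)%N -> (size f <= n)%N) ->
  \big[op/idx]_(f : {poly_n F} | p f) G f =
  \big[op/idx]_(f : {poly_N F} | p f) G f.
Proof.
move=> nN psize.
rewrite [RHS](reindex_onto (fun f : {poly_n F} => npolyp N f)
                           (fun f : {poly_N F} => npolyp n f)) /=; last first.
  move=> f pf; apply: val_inj => /=; rewrite !npolypK ?size_npoly//.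
  exact: psize.
apply: eq_big => [f|f _]; last by rewrite npolypK// (leq_trans (size_npoly _)).
have fN : npolyp N f = f :> {poly F}.
  by rewrite npolypK// (leq_trans (size_npoly _)).
rewrite fN; suff -> : npolyp n f = f by rewrite eqxx andbT.
by apply: val_inj; rewrite /= npolypK.
Qed.

(** Primes larger than [f] do not divide it, so they contribute a zeroth power. *)
Lemma jacobi_widen D f N : f != 0 -> (size f <= N)%N ->
  jacobi D f = \prod_(P : {poly_N F} | monic_irreducible P)
                 legendre D P ^+ multiplicity P f.
Proof.
move=> f0 fN; rewrite /jacobi.
pose p P := monic_irreducible P && (size P <= size f)%N.
transitivity (\prod_(P : {poly_(size f) F} | p P)
                 legendre D P ^+ multiplicity P f).
  by apply: eq_bigl => P; rewrite /p size_npoly andbT.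
rewrite (big_npoly_widen _ (p := p)
  (fun P => legendre D P ^+ multiplicity P f) fN) => [|P /andP[]//].
rewrite /p big_mkcondr; apply: eq_bigr => P /monic_irreducibleP[mP irrP].
case: ifPn => // nPf; rewrite multiplicity_ndvd ?irrP.1//.
by apply: contra nPf => /(dvdp_leq f0).
Qed.

Lemma jacobiM D f h : f != 0 -> h != 0 ->
  jacobi D (f * h) = jacobi D f * jacobi D h.
Proof.
move=> f0 h0; set N := (size f + size h)%N.
rewrite (@jacobi_widen D f N) ?leq_addr// (@jacobi_widen D h N) ?leq_addl//.
rewrite (@jacobi_widen D _ N) ?mulf_neq0//; last first.
  by rewrite (leq_trans (size_polyMleq _ _)) ?leq_pred.
rewrite -big_split; apply: eq_bigr => P /monic_irreducibleP[_ irrP].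
by rewrite multiplicityM// exprD.
Qed.

Lemma jacobi1 D : jacobi D 1 = 1.
Proof.
rewrite /jacobi big1// => P /monic_irreducibleP[_ irrP].
by rewrite multiplicity_ndvd ?irrP.1 ?oner_eq0// dvdp1 gtn_eqF ?irrP.1.
Qed.

(** Makes the prime chosen by [xget] in [Lambda] unambiguous. *)
Lemma prime_power_inj P Q e e' : monic_irreducible P -> monic_irreducible Q ->
  (0 < e)%N -> P ^+ e = Q ^+ e' -> P = Q.
Proof.
move=> /monic_irreducibleP[mP irrP] /monic_irreducibleP[mQ irrQ] e0 PQ.
apply: monic_irreducible_dvd_eq => //; apply: (@irreducible_dvdX _ _ _ e') => //.
by rewrite -PQ -(prednK e0) exprS dvdp_mulr.
Qed.

Lemma Lambda_prime_power P e : monic_irreducible P -> (0 < e)%N ->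
  Lambda (P ^+ e) = (size P).-1.
Proof.
move=> irrP e0; rewrite /Lambda; case: xgetP => [Q _ [irrQ [e' [e'0 PQ]]]|/(_ P)].
  by rewrite (prime_power_inj irrP irrQ e0 PQ).
by case; split=> //; exists e.
Qed.

Lemma Lambda_neq0 f : Lambda f != 0%N ->
  exists P e, [/\ monic_irreducible P, (0 < e)%N & f = P ^+ e].
Proof.
rewrite /Lambda; case: xgetP => [P _ [irrP [e [e0 ->]]] _|_].
  by exists P, e.
by rewrite size_poly1.
Qed.

Lemma Lambda1 : Lambda (1 : {poly F}) = 0%N.
Proof.
apply/eqP; case: eqP => // /eqP /Lambda_neq0[P [e]].
case=> /monic_irreducibleP[_ irrP] e0 E; have := irrP.1.
have : P %| 1 by rewrite E -(prednK e0) exprS dvdp_mulr.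
by rewrite dvdp1 => /eqP ->.
Qed.

(** Write f = f' P with P^m exactly dividing f'. The prime powers dividing f are those dividing f'
    together with P^(m+1), which adds deg P; f' is handled by induction on the size. *)
Lemma sum_Lambda_dvd N f : f \is monic -> (size f <= N)%N ->
  (\sum_(h : {poly_N F} | (polyn h \is monic) && (polyn h %| f)%R)
     Lambda h = (size f).-1)%N.
Proof.
have [n] := ubnP (size f); elim: n f => // n IH f fn mf fN.
have f0 := monic_neq0 mf.
have [f1|] := leqP (size f) 1.
  rewrite (monic_size_le1 mf f1) size_poly1 big1// => h /andP[mh].
  by rewrite dvdp1 => /eqP h1; rewrite (monic_size_le1 mh) ?h1// Lambda1.
move=> /exists_monic_irreducible_dvd[P [mP irrP Pf]].
have P1 := irrP.1.
have [f' fE] : exists f', f = f' * P by apply/dvdpP.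
have mf' : f' \is monic by move: mf; rewrite fE monicMr.
have f'0 := monic_neq0 mf'.
have sf : size f = (size f' + size P).-1 by rewrite fE size_Mmonic.
have sf'0 : (0 < size f')%N by rewrite size_poly_gt0.
have sf'f : (size f' < size f)%N.
  by rewrite sf; move: P1; case: (size P) => [|[|a]]// _; rewrite !addnS ltnS leq_addr.
have [m Pm nPm] := exists_multiplicity P1 f'0.
have mult := dvdp_exp_multiplicity _ Pm nPm.
have Ps : (size (P ^+ m.+1)%R <= N)%N.
  apply: leq_trans fN; apply: dvdp_leq => //.
  by rewrite fE exprSr dvdp_mul.
have irrP' : monic_irreducible P by apply/monic_irreducibleP.
rewrite (bigD1 (npolyp N (P ^+ m.+1))) /=; last first.
  by rewrite npolypK// monic_exp// fE exprSr dvdp_mul.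
rewrite npolypK// Lambda_prime_power//.
suff -> : (\sum_(h : {poly_N F} |
     ((polyn h \is monic) && (polyn h %| f)%R) && (h != npolyp N (P ^+ m.+1))) Lambda h =
     (size f').-1)%N.
  by rewrite sf; move: P1 sf'0; case: (size P) => // a; case: (size f') => // b;
     rewrite addSn addnS/= addnC.
rewrite -(IH f')//; [|exact: leq_trans sf'f fn|exact: leq_trans (ltnW sf'f) fN].
rewrite big_mkcond [RHS]big_mkcond /=; apply: eq_bigr => h _.
have [->|/Lambda_neq0[Q [e [irrQ e0 hE]]]] := eqVneq (Lambda h) 0%N.
  by rewrite !if_same.
congr (if _ then _ else _); case: (_ \is _) => //=.
have -> : (h == npolyp N (P ^+ m.+1)) = (polyn h == P ^+ m.+1).
  by rewrite -val_eqE /= npolypK.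
have [/monic_irreducibleP[mQ iQ]] := irrQ.
rewrite hE fE; have [QP|nQP] := eqVneq Q P.
  rewrite QP mult -(prednK e0) exprSr dvdp_mul2r ?irredp_neq0// mult -exprSr.
  have -> : (P ^+ e.-1.+1 == P ^+ m.+1) = (e.-1 == m).
    apply/eqP/eqP => [PP|->//]; have := congr1 (fun p : {poly F} => (size p).-1) PP.
    rewrite !size_monic_exp// => /eqP; rewrite eqn_mul2r -subn1 subn_eq0 leqNgt P1.
    by move=> /eqP[].
  by rewrite andbC -ltn_neqAle.
have nQ : Q ^+ e != P ^+ m.+1.
  by apply: contraNneq nQP => /(prime_power_inj irrQ irrP' e0) ->.
rewrite nQ andbT Gauss_dvdpl// coprimep_expl// irreducible_poly_coprime//.
by apply: contra nQP => QP; apply/eqP; exact: monic_irreducible_dvd_eq.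
Qed.

End Multiplicity.

(** * The coefficients of L(u, chi_D) *)

Section LCoefRecursion.
Variables (F : finFieldType) (D : {poly F}).
Implicit Types (f h : {poly F}) (n k : nat).

Definition Lambda_coef k : int :=
  \sum_(f : {poly_k.+1 F} | monic_deg k f) (Lambda f)%:R * jacobi D f.

Lemma sum_monic_deg_widen n N (G : {poly F} -> int) : (n <= N)%N ->
  \sum_(f : {poly_n.+1 F} | monic_deg n f) G f =
  \sum_(f : {poly_N.+1 F} | monic_deg n f) G f.
Proof.
move=> nN; apply: (big_npoly_widen _ (p := @monic_deg F n)) => //.
by move=> f /andP[_ /eqP ->].
Qed.

Lemma L_coef0 : L_coef D 0 = 1.
Proof.
rewrite /L_coef (big_pred1 (npolyp 1 1)) => [|f].
  by rewrite npolypK ?size_poly1// jacobi1.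
rewrite /= -val_eqE /= npolypK ?size_poly1// /monic_deg.
apply/idP/eqP => [/andP[mf /eqP sf]|->]; last by rewrite monic1 size_poly1.
by rewrite (monic_size_le1 mf) ?sf.
Qed.

(** The multiples are f = h m with m monic of degree n - k, and the symbol is multiplicative. *)
Lemma sum_jacobi_multiples n k h : monic_deg k h -> (k <= n)%N ->
  \sum_(f : {poly_n.+1 F} | monic_deg n f && (h %| f)) jacobi D f =
  jacobi D h * L_coef D (n - k).
Proof.
move=> /andP[mh /eqP sh] kn; have h0 := monic_neq0 mh.
rewrite /L_coef (sum_monic_deg_widen _ (leq_subr k n)) big_distrr /=.
have size_hM f : f != 0 -> size (h * f) = (k + size f)%N.
  by move=> f0; rewrite size_mul// sh addSn.
have divh_size (f : {poly_n.+1 F}) : (size (f %/ h)%R <= n.+1)%N.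
  exact: leq_trans (leq_divp _ _) (size_npoly f).
rewrite (reindex_onto (fun m : {poly_n.+1 F} => npolyp n.+1 (h * m))
                      (fun f : {poly_n.+1 F} => npolyp n.+1 (f %/ h))) /=;
    last first.
  move=> f /andP[/andP[mf _] hf]; apply: val_inj => /=.
  by rewrite [X in h * X]npolypK// mulrC divpK// npolypK ?size_npoly.
apply: eq_big => [m|m].
  apply/idP/idP => [|/andP[mm /eqP sm]].
    (* [mE] says that division by [h] recovers [m]; hence [npolyp] has not truncated [h * m]. *)
    set X := npolyp _ _ => /andP[/andP[/andP[mX /eqP sX] hX] /eqP mE].
    have XE : polyn X = h * m by rewrite -mE [polyn (npolyp _ (_ %/ _))]npolypK// mulrC divpK.
    have mm : polyn m \is monic by move: mX; rewrite XE monicMl.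
    move: sX; rewrite /monic_deg mm XE size_hM ?monic_neq0//=.
    by move=> sX; rewrite -(addKn k (size m)) sX subSn.
  have E : npolyp n.+1 (h * m) = h * m :> {poly F}.
    by rewrite npolypK// size_hM ?monic_neq0// sm; lia.
  rewrite /monic_deg E monicMl// mm size_hM ?monic_neq0// sm dvdp_mulIl/=.
  rewrite andbT; apply/andP; split; first by apply/eqP; lia.
  by rewrite -val_eqE /= mulKp// npolypK.
set X := npolyp _ _ => /andP[/andP[/andP[mX /eqP sX] hX] /eqP mE].
have XE : polyn X = h * m by rewrite -mE [polyn (npolyp _ (_ %/ _))]npolypK// mulrC divpK.
have mm : polyn m \is monic by move: mX; rewrite XE monicMl.
by rewrite XE jacobiM ?monic_neq0.
Qed.

(* Coefficientwise form of u L'(u) = L(u) * sum_f Lambda(f) chi_D(f) u^(deg f). *)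
Lemma L_coef_rec n :
  n%:R * L_coef D n = \sum_(1 <= k < n.+1) Lambda_coef k * L_coef D (n - k).
Proof.
(* The factor n = deg f becomes the sum of Lambda(h) over the monic divisors h of f. *)
transitivity (\sum_(f : {poly_n.+1 F} | monic_deg n f)
   \sum_(h : {poly_n.+1 F} | (polyn h \is monic) && (polyn h %| f))
     (Lambda h)%:R * jacobi D f).
  rewrite mulr_sumr; apply: eq_bigr => f /andP[mf /eqP sf].
  by rewrite -mulr_suml -natr_sum sum_Lambda_dvd ?sf.
rewrite (exchange_big_dep (fun h : {poly_n.+1 F} => polyn h \is monic)) /=; last first.
  by move=> f h _ /andP[].
(* The inner sum only keeps k = deg h. For h = 1 it is empty, in agreement with Lambda(1) = 0. *)
transitivity (\sum_(h : {poly_n.+1 F} | polyn h \is monic)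
   \sum_(1 <= k < n.+1) if size h == k.+1 then
     (Lambda h)%:R * jacobi D h * L_coef D (n - k) else 0).
  apply: eq_bigr => h mh.
  under eq_bigl do rewrite mh /=.
  rewrite -mulr_sumr; have [|h1] := leqP (size h) 1.
    move=> /(monic_size_le1 mh) h1; rewrite h1 Lambda1 mul0r big1// => k _.
    by rewrite !mul0r if_same.
  have hs : (size h).-1.+1 = size h by rewrite prednK//; apply: leq_trans h1.
  have hn : ((size h).-1 <= n)%N by rewrite -ltnS hs size_npoly.
  rewrite (bigD1_seq (size h).-1) /= ?iota_uniq//; last first.
    by rewrite mem_index_iota ltnS hn andbT -ltnS hs.
  rewrite hs eqxx [X in _ + X]big1 ?addr0 => [|k kh]; last first.
    by rewrite -hs eqSS eq_sym (negbTE kh).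
  rewrite (@sum_jacobi_multiples n (size h).-1)//; first by rewrite mulrA.
  by rewrite /monic_deg mh hs eqxx.
rewrite exchange_big /=; apply: eq_big_nat => k /andP[k1 kn].
rewrite /Lambda_coef (@sum_monic_deg_widen k n (fun h => (Lambda h)%:R * jacobi D h))//.
by rewrite -big_mkcondr mulr_suml.
Qed.
End LCoefRecursion.

(** * Newton's identities for products of factors 1 - v X *)

Section Newton.
Variable C : fieldType.
Implicit Types (v : C) (s : seq C) (n N : nat).

Definition power_sum s k : C := \sum_(v <- s) v ^+ k.

(** The logarithmic derivative X A'/A = - sum_k p_k X^k, multiplied by A and read modulo X^N to
    avoid power series. *)
Lemma log_derivative_dvd s N :
  let A := \prod_(v <- s) (1 - v *: 'X) in
  'X^N %| 'X * A^`() + A * \sum_(1 <= k < N) power_sum s k *: 'X^k.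
Proof.
elim: s => [|v s IH] /=.
  rewrite big_nil derivC mulr0 add0r big1 ?mulr0 ?dvdp0// => k _.
  by rewrite /power_sum big_nil scale0r.
move: IH => /=; rewrite big_cons.
set A := \prod_(_ <- _) _; set P := \sum_(_ <= _ < _) _ => IH.
have -> : \sum_(1 <= k < N) power_sum (v :: s) k *: 'X^k =
    \sum_(1 <= k < N) v ^+ k *: 'X^k + P.
  rewrite -big_split; apply: eq_bigr => k _.
  by rewrite /power_sum big_cons scalerDl.
set V := \sum_(_ <= _ < _) _.
(* A finite geometric sum; for N = 0 the sum is empty and the formula fails. *)
have VE : (0 < N)%N -> (1 - v *: 'X) * V = v *: 'X - v ^+ N *: 'X^N.
  rewrite /V; case: N {IH P V} => // N _.
  elim: N => [|N IH]; first by rewrite big_geq// mulr0 !expr1 subrr.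
  rewrite big_nat_recr//= mulrDr IH -!mul_polyC !rmorphXn/= !exprS; ring.
rewrite derivM derivB derivC derivZ derivX.
case: (posnP N) => [->|N0]; first by rewrite expr0 dvd1p.
(* Leibniz' rule, regrouped: the induction hypothesis covers the first summand, and by [VE] the
   second is - v^N A X^N. *)
have -> : 'X * ((0 - v *: 1) * A + (1 - v *: 'X) * A^`()) +
  (1 - v *: 'X) * A * (V + P) =
  (1 - v *: 'X) * ('X * A^`() + A * P) + A * ((1 - v *: 'X) * V - v *: 'X).
  by rewrite -!mul_polyC; ring.
rewrite VE// dvdp_add ?dvdp_mull//.
by rewrite addrC addKr dvdpNr -mul_polyC dvdp_mull.
Qed.

Lemma newton_identity s n :
  let A := \prod_(v <- s) (1 - v *: 'X) in
  n%:R * A`_n = - \sum_(1 <= k < n.+1) power_sum s k * A`_(n - k).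
Proof.
move=> A; have /dvdpP[Q] := log_derivative_dvd s n.+1.
(* The multiple Q X^(n+1) has coefficient 0 in degree n. *)
rewrite -/A => /(congr1 (fun p : {poly C} => p`_n)).
rewrite coefMXn ltnS leqnn coefD coefXM coef_deriv.
have -> : (if n == 0 then 0 else A`_n.-1.+1 *+ n.-1.+1) = n%:R * A`_n.
  by case: n => [|n]; rewrite ?mul0r//= mulr_natl.
move=> /eqP; rewrite addr_eq0 => /eqP ->; congr (- _).
rewrite mulr_sumr coef_sum; apply: eq_big_nat => k /andP[k1 kn].
by rewrite -scalerAr coefZ coefMXn ltnNge -ltnS kn.
Qed.

(** As A has constant coefficient 1, the term k = n of the recursion is a_n itself, so a_n is
    determined by the earlier values. *)
Lemma newton_identity_unique s (a : nat -> C) :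
  let A := \prod_(v <- s) (1 - v *: 'X) in
  (forall n, n%:R * A`_n = \sum_(1 <= k < n.+1) a k * A`_(n - k)) ->
  forall n, (0 < n)%N -> a n = - power_sum s n.
Proof.
move=> A aA n; have A0 : A`_0 = 1.
  rewrite -horner_coef0 horner_prod big1// => v _.
  by rewrite !hornerE ?mulr0 ?subr0.
elim/ltn_ind: n => -[//|n] IH _.
have := aA n.+1; rewrite newton_identity -/A big_nat_recr//= [in RHS]big_nat_recr//=.
rewrite subnn A0 !mulr1 opprD.
rewrite [in RHS](eq_big_nat _ _
  (F2 := fun k => - (power_sum s k * A`_(n.+1 - k)))) => [|k /andP[k1 kn]].
  by rewrite sumrN => /addrI.
by rewrite IH// mulNr.
Qed.

End Newton.

(** * Power sums of the inverse zeros of L(u, chi_D) *)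

Section ExplicitFormula.
Variables (R : realType) (F : finFieldType) (D : {poly F}).

(** A nonzero [L_poly] is not the default value of [xget], hence meets its specification. *)
Lemma L_poly_coef : L_poly R D != 0 ->
  forall n, (L_poly R D)`_n = (L_coef D n)%:~R.
Proof. by rewrite /L_poly; case: xgetP => // _; rewrite eqxx. Qed.

Lemma Lambda_coef_zeros (m : nat) (u : 'I_m -> R[i]) :
  (forall j, u j != 0) ->
  L_poly R D %= \prod_(j < m) ('X - (u j)%:P) ->
  forall n, (0 < n)%N ->
  (Lambda_coef D n)%:~R = - \sum_(j < m) (u j)^-1 ^+ n.
Proof.
move=> u0 zeros.
set B := \prod_(j < m) _ in zeros.
have B0 : B != 0 by apply/prodf_neq0 => j _; rewrite polyXsubC_eq0.
have L0 : L_poly R D != 0.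
  by apply: contraNneq B0 => L0; move: zeros; rewrite L0 eqp_sym eqp0.
have Lc := L_poly_coef L0.
pose s := [seq (u j)^-1 | j <- index_enum 'I_m].
have LA : L_poly R D = \prod_(v <- s) (1 - v *: 'X).
  rewrite big_map.
  (* Factorwise, X - u_j = - u_j (1 - X / u_j). *)
  have BE : B = (\prod_(j < m) (- u j)) *: \prod_(j < m) (1 - (u j)^-1 *: 'X).
    rewrite -scaler_prod; apply: eq_bigr => j _.
    by rewrite scalerBr scalerA mulNr divff// scaleN1r opprK addrC alg_polyC rmorphN.
  have := zeros; rewrite BE.
  set b := \prod_(j < m) _; set A := \prod_(j < m) _.
  have b0 : b != 0 by apply/prodf_neq0 => j _; rewrite oppr_eq0.
  have /eqp_rtrans -> : b *: A %= A by rewrite eqp_scale.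
  move=> /eqpP[[c d] /= /andP[c0 d0] cd].
  have A0 : A`_0 = 1.
    rewrite -horner_coef0 horner_prod big1// => v _.
    by rewrite !hornerE ?mulr0 ?subr0.
  (* L and A both have constant coefficient 1, so the factor left open by [%=] is 1. *)
  have := congr1 (fun p : {poly R[i]} => p`_0) cd.
  rewrite !coefZ A0 Lc L_coef0 !mulr1 => cdE; move: cd; rewrite cdE.
  by apply: scalerI.
move=> n n0.
rewrite (@newton_identity_unique _ s (fun n => (Lambda_coef D n)%:~R))//.
  by rewrite /power_sum big_map.
move=> k; rewrite -LA.
under [RHS]eq_bigr do rewrite Lc -intrM.
by rewrite Lc -(rmorph_sum intr) -L_coef_rec rmorphM /= rmorph_nat.
Qed.
End ExplicitFormula.

(** * The argument of P_K *)

Section ComplexExponential.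
Variable R : realType.
Local Notation C := R[i].
Implicit Types (x y t : R) (z : C).

Lemma ImD (z w : C) : complex.Im (z + w) = complex.Im z + complex.Im w.
Proof. by case: z => ? ?; case: w => ? ?. Qed.

Lemma Im_sum (I : Type) (r : seq I) (p : pred I) (G : I -> C) :
  complex.Im (\sum_(i <- r | p i) G i) = \sum_(i <- r | p i) complex.Im (G i).
Proof. by apply: (big_morph _ ImD). Qed.

Lemma Im_realM x z : complex.Im ((x%:C)%C * z) = x * complex.Im z.
Proof. by case: z => a b /=; rewrite mul0r addr0. Qed.

Lemma cisD x y : cis (x + y) = cis x * cis y.
Proof.
apply/eqP; rewrite eq_complex /= cosD sinD.
by rewrite [sin x * _ + _]addrC !eqxx.
Qed.

Lemma e_D x y : e_ (x + y) = e_ x * e_ y.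
Proof. by rewrite /e_ mulrDr cisD. Qed.

Lemma e_0 : e_ 0 = 1 :> C.
Proof. by rewrite /e_ mulr0 /cis cos0 sin0. Qed.

Lemma e_X x k : e_ x ^+ k = e_ (x * k%:R).
Proof.
elim: k => [|k IH]; first by rewrite mulr0 e_0.
by rewrite exprS IH -e_D -[in LHS](mulr1 x) -mulrA mul1r -mulrDr -natr1 addrC.
Qed.

Lemma e_VN x : (e_ x)^-1 = e_ (- x).
Proof.
have e1 : e_ x * e_ (- x) = 1 by rewrite -e_D subrr e_0.
have ex0 : e_ x != 0 by apply: contra_eq_neq e1 => ->; rewrite mul0r eq_sym oner_eq0.
by apply: (mulfI ex0); rewrite divff.
Qed.

Lemma e_nat n : e_ n%:R = 1 :> C.
Proof.
rewrite -[n%:R]mul1r -e_X /e_ mulr1 /cis mulr_natl cos2pi sin2pi.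
exact: expr1n.
Qed.

Lemma e_int (n : int) : e_ n%:~R = 1 :> C.
Proof.
case: n => n; first by rewrite -pmulrn e_nat.
by rewrite NegzE mulrNz -e_VN -pmulrn e_nat invr1.
Qed.

Lemma e_fracpart x : e_ (fracpart x) = e_ x.
Proof. by rewrite /fracpart e_D -mulrNz e_int mulr1. Qed.

Lemma norm_cis x : `|cis x| = 1.
Proof. by rewrite normc_def /= cos2Dsin2 sqrtr1. Qed.

Lemma norm_cexp z : `|cexp z| = ((expR (complex.Re z))%:C)%C.
Proof.
by rewrite /cexp normrM norm_cis mulr1 ger0_norm// lecR expR_ge0.
Qed.

Lemma cis_eq_cosB x y : cis x = cis y -> cos (x - y) = 1.
Proof. by case=> cxy sxy; rewrite cosB cxy sxy -!expr2 cos2Dsin2. Qed.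

(* A continuous d with values in 2 pi Z is constant: if d increased, it would
   take a value d a + delta with 0 < delta <= pi, where cos is smaller than 1. *)
Lemma continuous_cos_eq1_le (a b : R) (d : R -> R) : a <= b ->
  {within `[a, b], continuous d} ->
  {in `[a, b], forall t, cos (d t) = 1} -> d b <= d a.
Proof.
move=> ab dc d1; rewrite leNgt; apply/negP => dab.
pose delta := Num.min (d b - d a) pi.
have delta_gt0 : 0 < delta by rewrite lt_min subr_gt0 dab pi_gt0.
have [|c cab dE] := IVT (v := d a + delta) ab dc.
  rewrite (min_idPl (ltW dab)) (max_idPr (ltW dab)) lerDl ltW//=.
  by rewrite -lerBrDl ge_min lexx.
have := d1 c cab; have da1 : cos (d a) = 1 by rewrite d1// in_itv/= lexx.
have sa0 : sin (d a) = 0 by rewrite cos1sin0// da1 normr1.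
rewrite dE cosD da1 sa0 mul1r mul0r subr0 => cd.
have : cos delta < cos 0.
  rewrite ltr_cos// in_itv/= ?lexx ?pi_ge0// (ltW delta_gt0).
  by rewrite /delta ge_min lexx orbT.
by rewrite cd cos0 ltxx.
Qed.

(** Two continuous determinations differ by a function whose cosine is 1, so the previous lemma,
    used in both directions, gives them the same increment, and [get] has a single value to
    return. *)
Lemma arg_change_eq (a b : R) (w : R -> C) (phi : R -> R) : a <= b ->
  {within `[a, b], continuous phi} ->
  {in `[a, b], forall t, w t != 0} ->
  {in `[a, b], forall t, w t = `|w t| * cis (phi t)} ->
  arg_change a b w = phi b - phi a.
Proof.
move=> ab phic w0 wphi; apply: get_unique; first by exists phi.
move=> _ [psi [psic wpsi ->]].
have le f h : {within `[a, b], continuous f} -> {within `[a, b], continuous h} ->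
    {in `[a, b], forall t, w t = `|w t| * cis (f t)} ->
    {in `[a, b], forall t, w t = `|w t| * cis (h t)} -> f b - f a <= h b - h a.
  move=> fc hc wf wh.
  suff : (f - h) b <= (f - h) a by rewrite /= !fctE; lra.
  apply: continuous_cos_eq1_le => //.
    exact: within_continuousB.
  move=> t tab; apply: cis_eq_cosB; apply: (mulfI (x := `|w t|)).
    by rewrite normr_eq0 w0.
  by rewrite -wf// -wh.
by apply/eqP; rewrite eq_le !le.
Qed.

End ComplexExponential.

(** * Evaluation of the argument along the path *)

Section ArgumentFormula.
Variables (R : realType) (F : finFieldType) (D : {poly F}).
Local Notation C := R[i].
Implicit Types (theta t : R) (K k : nat) (u : C).
Local Notation q := (#|F|%:R : R).

(** A logarithm of P_K that is polynomial in u; its imaginary part is a continuous argument. *)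
Definition log_P K u : C :=
  \sum_(1 <= k < K.+1) (Lambda_coef D k)%:~R * u ^+ k / k%:R.

Lemma P_E K u : P_ D K u = cexp (log_P K u).
Proof.
congr cexp; apply: eq_bigr => k _.
rewrite rmorph_sum/= -!mulrA mulr_suml; apply: eq_bigr => f _.
by rewrite rmorphM/= rmorph_nat -!mulrA.
Qed.

Lemma Im_log_P K (r x : R) :
  complex.Im (log_P K ((r%:C)%C * e_ x)) =
  \sum_(1 <= k < K.+1) (Lambda_coef D k)%:~R * r ^+ k / k%:R *
                       sin (2 * pi * (x * k%:R)).
Proof.
rewrite Im_sum; apply: eq_bigr => k _.
set c := _ * _ / _.
have -> : c = ((((Lambda_coef D k)%:~R * r ^+ k / k%:R : R)%:C)%C * e_ (x * k%:R)).
  rewrite /c exprMn e_X !(rmorphM (real_complex R)) fmorphV/= rmorphXn/=.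
  by rewrite rmorph_int rmorph_nat; ring.
by rewrite Im_realM.
Qed.

(** One polar form for both pieces of the path, with modulus and angle visibly continuous in t. *)
Lemma Gamma_polar theta t : 0 <= t <= 2 ->
  Gamma F theta t =
  ((q ^- 2 + Num.max (t - 1) 0 * (radius R F - q ^- 2))%:C)%C *
  e_ (Num.min t 1 * fracpart theta).
Proof.
rewrite /Gamma => /andP[t0 t2]; have [t1|t1] := leP t 1.
  by rewrite (max_idPr _) ?subr_le0// mul0r addr0.
rewrite (max_idPl _) ?subr_ge0 ?ltW// mul1r e_fracpart; congr ((_%:C)%C * _).
by ring.
Qed.

Lemma continuous_sumr (I : Type) (r : seq I) (p : pred I) (f : I -> R -> R) :
  (forall i, continuous (f i)) ->
  continuous (fun t => \sum_(i <- r | p i) f i t).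
Proof.
move=> fc; elim: r => [|i r IH] t.
  by under eq_fun do rewrite big_nil; exact: cvg_cst.
under eq_fun do rewrite big_cons.
case: (p i); last exact: IH.
by apply: continuousD; [exact: fc|exact: IH].
Qed.

Lemma arg_P_E K theta :
  arg_P D K theta = - complex.Im (log_P K (circle_pt F theta)).
Proof.
rewrite /arg_P; congr (- _).
pose r t := q ^- 2 + Num.max (t - 1) 0 * (radius R F - q ^- 2).
pose s k t := 2 * pi * (Num.min t 1 * fracpart theta * k%:R).
pose phi t :=
  \sum_(1 <= k < K.+1) (Lambda_coef D k)%:~R * r t ^+ k / k%:R * sin (s k t).
have phiE t : 0 <= t <= 2 -> phi t = complex.Im (log_P K (Gamma F theta t)).
  by move=> t02; rewrite Gamma_polar// Im_log_P.
rewrite (@arg_change_eq _ _ _ _ phi) ?ler0n//.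
(* The path starts at the real number q^-2, where every sine vanishes, and ends at
   [circle_pt F theta]. *)
- rewrite [phi 0]big1 ?subr0 => [|k _]; last first.
    by rewrite /s (min_idPl _)// !mul0r mulr0 sin0 mulr0.
  have t2 : 0 <= (2 : R) <= 2 by rewrite lexx ler0n.
  rewrite (phiE _ t2) /Gamma (lt_geF (ltr1n R 2)).
  rewrite /circle_pt; congr (complex.Im (log_P K ((_%:C)%C * _))); ring.
- have rc : continuous r.
    move=> t; apply: cvgD; first exact: cvg_cst.
    apply: cvgM; last exact: cvg_cst.
    apply: (@continuous_max R R (fun t => t - 1) (fun=> 0) t); last exact: cvg_cst.
    by apply: cvgB; [exact: cvg_id|exact: cvg_cst].
  have sc k : continuous (s k).
    move=> t; apply: cvgM; first exact: cvg_cst.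
    apply: cvgM; last exact: cvg_cst.
    apply: cvgM; last exact: cvg_cst.
    by apply: (@continuous_min R R id (fun=> 1) t); [exact: cvg_id|exact: cvg_cst].
  apply: continuous_subspaceT; apply: continuous_sumr => k t.
  apply: cvgM; [apply: cvgM; [apply: cvgM|]|]; try exact: cvg_cst.
    exact: (continuous_comp (rc t) (@exprn_continuous _ _ _)).
  exact: (continuous_comp (sc k t) (@continuous_sin _ _)).
- by move=> t _; rewrite P_E -normr_eq0 norm_cexp eq_complex /= gt_eqF ?expR_gt0.
- move=> t; rewrite in_itv /= => t02.
  by rewrite P_E norm_cexp phiE.
Qed.

Lemma radius_gt0 : 0 < radius R F.
Proof.
by rewrite invr_gt0 sqrtr_gt0 ltr0n; apply/card_gt0P; exists 0.
Qed.

Lemma circle_pt_neq0 theta : circle_pt F theta != 0.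
Proof.
rewrite mulf_neq0//; first by rewrite eq_complex /= gt_eqF ?radius_gt0.
by rewrite -normr_eq0 norm_cis oner_eq0.
Qed.

Lemma circle_pt_div theta theta' :
  (circle_pt F theta')^-1 * circle_pt F theta = e_ (theta - theta').
Proof.
rewrite mulrC /circle_pt -mulf_div divff ?mul1r ?e_VN ?e_D//.
by rewrite eq_complex /= gt_eqF ?radius_gt0.
Qed.

(** As a_k = - sum_j u_j^(-k), the k-th term of [log_P] is the sum over j of - e(k (theta -
    theta_j)) / k, and its sign cancels the one in [arg_P]. *)
Lemma S_formula (m : nat) (theta_ : 'I_m -> R)
    (zeros : L_poly R D %= \prod_(j < m) ('X - (circle_pt F (theta_ j))%:P)) K theta :
  S_ D K theta = \sum_(j < m) \sum_(1 <= k < K.+1)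
     sin (2 * pi * (theta - theta_ j) * k%:R) / (pi * k%:R).
Proof.
rewrite /S_ arg_P_E exchange_big /= Im_sum -sumrN mulr_sumr.
apply: eq_big_nat => k /andP[k1 _].
rewrite (Lambda_coef_zeros (fun j => circle_pt_neq0 (theta_ j)) zeros k1).
rewrite mulNr mulNr mulr_suml mulr_suml -sumrN Im_sum -sumrN mulr_sumr.
apply: eq_bigr => j _.
rewrite -exprMn circle_pt_div e_X.
set x := (theta - theta_ j).
have -> : - (e_ (x * k%:R) / k%:R) = (((- k%:R^-1 : R)%:C)%C * e_ (x * k%:R)).
  by rewrite rmorphN/= fmorphV/= rmorph_nat mulNr mulrC.
by rewrite Im_realM /= mulNr opprK invfM mulrA mulrA mulrC mulrA mulrC.
Qed.

End ArgumentFormula.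

(** * The remainder E_K *)

Section SawtoothBound.
Variable R : realType.
Implicit Types (x y v a t : R) (K k : nat).

(** B + h and B - h have nonnegative derivatives, hence nonnegative increments by the mean value
    theorem. *)
Lemma norm_increment_le (h B dh dB : R -> R) (a b : R) : a <= b ->
  (forall x, x \in `[a, b] -> is_derive x 1 h (dh x)) ->
  (forall x, x \in `[a, b] -> is_derive x 1 B (dB x)) ->
  (forall x, x \in `[a, b] -> `|dh x| <= dB x) ->
  `|h b - h a| <= B b - B a.
Proof.
move=> ab hd Bd hB.
have step (f df : R -> R) : (forall x, x \in `[a, b] -> is_derive x 1 f (df x)) ->
    (forall x, x \in `[a, b] -> 0 <= df x) -> 0 <= f b - f a.
  move=> fd df0.
  have fo x : x \in `]a, b[ -> is_derive x 1 f (df x).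
    by rewrite in_itv/= => /andP[ax xb]; apply: fd; rewrite in_itv/= !ltW.
  have fc : {within `[a, b], continuous f}.
    by apply: derivable_within_continuous => x xab; have [] := fd x xab.
  have [c cab ->] := MVT_segment ab fo fc.
  by rewrite mulr_ge0 ?df0 ?subr_ge0.
rewrite ler_norml; apply/andP; split.
  have := step (B + h) (dB + dh); rewrite !fctE => H.
  rewrite -subr_ge0; have -> : h b - h a - - (B b - B a) = B b + h b - (B a + h a) by ring.
  apply: H => x xab; first by have := hd x xab; have := Bd x xab; exact: is_deriveD.
  by have := hB x xab; rewrite ler_norml; lra.
have := step (B - h) (dB - dh); rewrite !fctE => H.
rewrite -subr_ge0; have -> : B b - B a - (h b - h a) = B b - h b - (B a - h a) by ring.
apply: H => x xab; first by have := hd x xab; have := Bd x xab; exact: is_deriveB.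
by have := hB x xab; rewrite ler_norml; lra.
Qed.

(* This is |e^(ia) - t|^2. *)
Definition sqdist_cis a t : R := 1 - 2 * t * cos a + t ^+ 2.

Lemma sin_recurrence a k :
  sin (a * k%:R) + sin (a * k.+2%:R) = 2 * cos a * sin (a * k.+1%:R).
Proof.
have -> : a * k%:R = a * k.+1%:R - a by rewrite -[k.+1%:R]natr1; ring.
have -> : a * k.+2%:R = a * k.+1%:R + a by rewrite -[k.+2%:R]natr1; ring.
by rewrite sinB sinD; ring.
Qed.

(** This is 2/v times the imaginary part of the geometric sum of (v^2 e^(ia))^k, with the
    denominator |1 - v^2 e^(ia)|^2 cleared. *)
Lemma sum_sin_closed_form a v K :
  sqdist_cis a (v ^+ 2) *
    \sum_(1 <= k < K.+1) 2 * v ^+ (2 * k).-1 * sin (a * k%:R) =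
  2 * v * sin a -
  2 * v ^+ (2 * K).+1 * (sin (a * K.+1%:R) - v ^+ 2 * sin (a * K%:R)).
Proof.
elim: K => [|K IH].
  by rewrite big_geq// mulr0 muln0 !mulr0 sin0 mulr1 mulr0 subr0 expr1 subrr.
rewrite big_nat_recr// mulrDr IH mulnS add2n [in LHS]succnK !exprS /sqdist_cis.
have := sin_recurrence a K.
set s0 := sin _; set s1 := sin (a * K.+1%:R); set s2 := sin (a * K.+2%:R) => E.
have -> : s0 = 2 * cos a * s1 - s2 by rewrite -E addrK.
by ring.
Qed.

(** By half angles, the squared distance is (1 - t)^2 + 4 t sin(pi x)^2. *)
Lemma sqdist_cis_ge x t : 4 * t * sin (pi * x) ^+ 2 <= sqdist_cis (2 * pi * x) t.
Proof.
have -> : sqdist_cis (2 * pi * x) t = (1 - t) ^+ 2 + 4 * t * sin (pi * x) ^+ 2.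
  have -> : 2 * pi * x = (pi * x) *+ 2 by rewrite -mulrA mulr_natl.
  by rewrite /sqdist_cis cos_mulr2n cos2sin2; ring.
by rewrite lerDr sqr_ge0.
Qed.

(** The quantity squared is the imaginary part of e^(ika) (e^(ia) - t), whose squared modulus is
    [sqdist_cis a t]. *)
Lemma sqdist_cis_bound a t k :
  (sin (a * k.+1%:R) - t * sin (a * k%:R)) ^+ 2 <= sqdist_cis a t.
Proof.
have -> : sin (a * k.+1%:R) = sin (a * k%:R) * cos a + cos (a * k%:R) * sin a.
  by rewrite -sinD -natr1 mulrDr mulr1.
have := cos2Dsin2 a; have := cos2Dsin2 (a * k%:R); rewrite /sqdist_cis.
move: (cos a) (sin a) (cos (a * _)) (sin (a * _)) => c s C S CS cs.
have -> : 1 - 2 * t * c + t ^+ 2 = (C ^+ 2 + S ^+ 2) * ((c - t) ^+ 2 + s ^+ 2).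
  rewrite CS mul1r.
  have -> : (c - t) ^+ 2 + s ^+ 2 = (c ^+ 2 + s ^+ 2) - 2 * t * c + t ^+ 2 by ring.
  by rewrite cs.
rewrite -subr_ge0.
(* The difference is the square of the real part. *)
have -> : (C ^+ 2 + S ^+ 2) * ((c - t) ^+ 2 + s ^+ 2) - (S * c + C * s - t * S) ^+ 2 =
    (C * (c - t) - S * s) ^+ 2 by ring.
exact: sqr_ge0.
Qed.

Lemma sin_gt0_01 x : 0 < x < 1 -> 0 < sin (pi * x).
Proof.
move=> /andP[x0 x1]; apply: sin_gt0_pi.
by rewrite mulr_gt0 ?pi_gt0//= -[ltRHS]mulr1 ltr_pM2l ?pi_gt0.
Qed.

Lemma sqdist_cis_kernel_le x v k : 0 < x < 1 -> 0 < v ->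
  `|2 * v ^+ (2 * k).+1 *
    (sin (2 * pi * x * k.+1%:R) - v ^+ 2 * sin (2 * pi * x * k%:R)) /
    sqdist_cis (2 * pi * x) (v ^+ 2)| <= v ^+ (2 * k) / sin (pi * x).
Proof.
move=> x01 v0; have s0 := sin_gt0_01 x01.
have := sqdist_cis_bound (2 * pi * x) (v ^+ 2) k.
have := sqdist_cis_ge x (v ^+ 2).
set d := sqdist_cis _ _; set N := sin _ - _; set s := sin (pi * x) in s0 * => ds Nd.
have d0 : 0 < d by apply: lt_le_trans ds; rewrite !mulr_gt0 ?exprn_gt0.
(* After squaring, this is the product of (2 v s)^2 <= d and N^2 <= d. *)
have main : 2 * v * s * `|N| <= d.
  rewrite -(@ler_pXn2r _ 2) ?nnegrE ?mulr_ge0 ?normr_ge0 ?(ltW d0) ?(ltW v0) ?(ltW s0)//.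
  rewrite exprMn real_normK ?num_real// [d ^+ 2]expr2.
  apply: ler_pM => //; rewrite ?sqr_ge0//.
  by apply: le_trans ds; rewrite le_eqVlt; apply/orP; left; apply/eqP; ring.
rewrite !normrM normfV (gtr0_norm d0) (@ger0_norm _ 2)// ger0_norm ?exprn_ge0 ?(ltW v0)//.
rewrite ler_pdivrMr// [leRHS]mulrAC ler_pdivlMr// exprS.
rewrite (_ : _ * s = v ^+ (2 * k) * (2 * v * s * `|N|)); last by ring.
by rewrite ler_pM2l// exprn_gt0.
Qed.

(** The Abel variable is r = v^2: in r the derivative of the remainder would be bounded by a
    multiple of r^(K - 1/2), and the substitution makes the exponent an integer. *)
Definition abel_poly a K : {poly R} :=
  \sum_(1 <= k < K.+1) (sin (a * k%:R) / k%:R) *: 'X^(2 * k).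

Lemma abel_poly_deriv a K v : (abel_poly a K)^`().[v] =
  \sum_(1 <= k < K.+1) 2 * v ^+ (2 * k).-1 * sin (a * k%:R).
Proof.
rewrite /abel_poly (big_morph _ (@derivD R) (derivC 0)) horner_sum.
apply: eq_big_nat => k /andP[k1 _].
rewrite derivZ derivXn hornerZ hornerMn hornerXn -[_ *+ (2 * k)]mulr_natr natrM.
by field; rewrite pnatr_eq0 -lt0n.
Qed.

(* The difference between the K-th partial sum of the series of
   -Im log(1 - v^2 e^(ia)) and the function itself. *)
Definition abel_remainder a K v : R :=
  (abel_poly a K).[v] - atan (sin a * v ^+ 2 / (1 - cos a * v ^+ 2)).

(** The arctangent has derivative 2 v sin a / |1 - v^2 e^(ia)|^2, which cancels the main term of
    [sum_sin_closed_form]. *)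
Lemma abel_remainder_derive a K v : 0 < 1 - cos a * v ^+ 2 ->
  is_derive v 1 (abel_remainder a K)
   (- (2 * v ^+ (2 * K).+1 * (sin (a * K.+1%:R) - v ^+ 2 * sin (a * K%:R)) /
     sqdist_cis a (v ^+ 2))).
Proof.
move=> M0; have M1 := lt0r_neq0 M0.
pose N : {poly R} := sin a *: 'X^2; pose M : {poly R} := 1 - cos a *: 'X^2.
have NE y : N.[y] = sin a * y ^+ 2 by rewrite !hornerE.
have ME y : M.[y] = 1 - cos a * y ^+ 2 by rewrite !hornerE.
have MD : is_derive v 1 (fun y => (M.[y])^-1) (- (M.[v]) ^- 2 *: M^`().[v]).
  by apply: is_deriveV; rewrite ME.
have -> : abel_remainder a K =
    horner (abel_poly a K) - (@atan R \o (horner N * (fun y => (M.[y])^-1))).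
  by apply/funext => y; rewrite !fctE /= NE ME.
apply: is_derive_eq.
rewrite abel_poly_deriv /= !fctE.
have dE : sqdist_cis a (v ^+ 2) = M.[v] ^+ 2 + N.[v] ^+ 2.
  by rewrite NE ME /sqdist_cis [(sin a * _) ^+ 2]exprMn sin2cos2; ring.
have d0 : sqdist_cis a (v ^+ 2) != 0.
  by rewrite dE gt_eqF// ltr_wpDr ?sqr_ge0// exprn_gt0// ME.
have := sum_sin_closed_form a v K; set S := \sum_(_ <= _ < _) _ => SE.
have SE' : S = (2 * v * sin a - 2 * v ^+ (2 * K).+1 *
    (sin (a * K.+1%:R) - v ^+ 2 * sin (a * K%:R))) / sqdist_cis a (v ^+ 2).
  by rewrite -SE mulrC mulKf.
have N'E : N^`().[v] = 2 * sin a * v.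
  by rewrite derivZ derivXn !hornerE; ring.
have M'E : M^`().[v] = - (2 * cos a * v).
  by rewrite derivB derivC derivZ derivXn !hornerE; ring.
rewrite SE' N'E M'E /GRing.scale /= dE; move: d0; rewrite dE NE ME => d0.
by field; rewrite M1 d0.
Qed.

(** * Elementary inequalities for the sine *)

Lemma sin_MVT x y : x <= y ->
  exists2 c, x <= c <= y & sin y - sin x = cos c * (y - x).
Proof.
move=> xy; have [c cxy E] := MVT_segment xy (fun z _ => is_derive_sin z)
  (continuous_subspaceT (@continuous_sin R)).
by exists c => //; move: cxy; rewrite in_itv.
Qed.

Lemma sin_le_id x : 0 <= x -> sin x <= x.
Proof.
move=> x0; have [c _] := sin_MVT x0; rewrite sin0 !subr0 => ->.
by rewrite -[leRHS]mul1r ler_wpM2r// cos_le1.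
Qed.

(* Jordan's inequality: the slope of sin over [0, pi x] is at least that over
   [pi x, pi / 2]. *)
Lemma sin_ge_2x x : 0 <= x <= 2^-1 -> 2 * x <= sin (pi * x).
Proof.
move=> /andP[x0 x1]; have p0 := pi_gt0 R.
have u0 : 0 <= pi * x by rewrite mulr_ge0// ltW.
have u1 : pi * x <= pi / 2 by rewrite ler_pM2l.
have [c1 /andP[c10 c1u]] := sin_MVT u0; rewrite sin0 !subr0 => E1.
have [c2 /andP[c2u c21]] := sin_MVT u1; rewrite sin_pihalf => E2.
have c12 : cos c2 <= cos c1.
  have [->//|c12] := eqVneq c1 c2; rewrite ltW// ltr_cos ?in_itv/=; lra.
(* The comparison of slopes, cleared of denominators; by [E1] and [E2] the product equals (pi / 2)
   (sin(pi x) - 2 x). *)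
have : 0 <= (cos c1 - cos c2) * (pi * x * (pi / 2 - pi * x)).
  by rewrite !mulr_ge0 ?subr_ge0 ?(ltW p0).
have -> : (cos c1 - cos c2) * (pi * x * (pi / 2 - pi * x)) =
  (cos c1 * (pi * x)) * (pi / 2 - pi * x) - (cos c2 * (pi / 2 - pi * x)) * (pi * x).
  by ring.
rewrite -E1 -E2.
have -> : sin (pi * x) * (pi / 2 - pi * x) - (1 - sin (pi * x)) * (pi * x) =
  (pi / 2) * (sin (pi * x) - 2 * x) by field.
by rewrite pmulr_rge0 ?divr_gt0// subr_ge0.
Qed.

(** Agrees with [E_ K] on the open unit interval, without the case distinction at integers. *)
Definition saw_remainder K y : R :=
  y - 2^-1 + \sum_(1 <= k < K.+1) sin (2 * pi * y * k%:R) / (pi * k%:R).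

Lemma cos_2pi_lt1 x : 0 < x < 1 -> cos (2 * pi * x) < 1.
Proof.
move=> /sin_gt0_01 s0.
have -> : 2 * pi * x = (pi * x) *+ 2 by rewrite -mulrA mulr_natl.
rewrite cos_mulr2n cos2sin2; have := exprn_gt0 2 s0; lra.
Qed.

Lemma abel_remainder0 a K : abel_remainder a K 0 = 0.
Proof.
rewrite /abel_remainder expr0n mulr0 mul0r atan0 subr0 /abel_poly horner_sum.
apply: big1_seq => k /andP[_]; rewrite mem_index_iota => /andP[k1 _].
by rewrite hornerZ hornerXn expr0n muln_eq0 /= eqn0Ngt k1 mulr0.
Qed.

(** The argument of the arctangent is cot(pi x) = tan(pi/2 - pi x), and pi/2 - pi x lies strictly
    between -pi/2 and pi/2. *)
Lemma abel_remainder1 x K : 0 < x < 1 ->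
  abel_remainder (2 * pi * x) K 1 = pi * saw_remainder K x.
Proof.
move=> x01; have s0 := sin_gt0_01 x01; have p0 := pi_gt0 R.
rewrite /abel_remainder expr1n !mulr1.
have -> : sin (2 * pi * x) / (1 - cos (2 * pi * x)) = tan (pi / 2 - pi * x).
  rewrite /tan sinB cosB sin_pihalf cos_pihalf.
  have -> : 2 * pi * x = (pi * x) *+ 2 by rewrite -mulrA mulr_natl.
  rewrite cos_mulr2n sin_mulr2n cos2sin2.
  field; rewrite gt_eqF//=.
  have -> : 1 - ((1 - sin (pi * x) ^+ 2) * 2 - 1) = 2 * sin (pi * x) ^+ 2 by ring.
  by rewrite mulf_neq0 ?expf_neq0// gt_eqF.
rewrite tanK; last first.
  by rewrite in_itv/=; move: x01 => /andP[x0 x1]; apply/andP; split; nra.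
rewrite /saw_remainder /abel_poly horner_sum [RHS]mulrDr mulr_sumr addrC.
congr (_ + _); first by field.
apply: eq_big_nat => k /andP[k1 _]; rewrite hornerZ hornerXn expr1n mulr1.
move: (pi : R) p0 (sin _) => p p0 u.
by field; rewrite pnatr_eq0 -lt0n k1 gt_eqF.
Qed.

Lemma saw_remainder_le x K : 0 < x < 1 ->
  `|saw_remainder K x| <= ((2 * K%:R + 1) * pi * sin (pi * x))^-1.
Proof.
move=> x01; have s0 := sin_gt0_01 x01; have p0 := pi_gt0 R.
have c1 := cos_2pi_lt1 x01; have K0 : 0 < (2 * K%:R + 1 : R) by rewrite ltr_wpDl// mulr_ge0.
(* The primitive of v^(2K) / sin(pi x) that vanishes at 0. *)
pose B : {poly R} := ((2 * K%:R + 1) * sin (pi * x))^-1 *: 'X^((2 * K).+1).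
have BE y : B.[y] = ((2 * K%:R + 1) * sin (pi * x))^-1 * y ^+ (2 * K).+1.
  by rewrite !hornerE.
have B'E y : B^`().[y] = y ^+ (2 * K) / sin (pi * x).
  rewrite derivZ derivXn hornerZ hornerMn hornerXn -[_ *+ (2 * K).+1]mulr_natr.
  by rewrite -[(2 * K).+1%:R]natr1 natrM; field; rewrite !gt_eqF.
have := @norm_increment_le (abel_remainder (2 * pi * x) K) (horner B)
  (fun v => - (2 * v ^+ (2 * K).+1 * (sin (2 * pi * x * K.+1%:R) -
     v ^+ 2 * sin (2 * pi * x * K%:R)) / sqdist_cis (2 * pi * x) (v ^+ 2)))
  (fun v => B^`().[v]) 0 1 ler01.
rewrite abel_remainder1// abel_remainder0 !BE expr0n mulr0 !subr0 expr1n mulr1.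
move=> H; have {H} : `|pi * saw_remainder K x| <= ((2 * K%:R + 1) * sin (pi * x))^-1.
  apply: H => v; rewrite in_itv/= => /andP[v0 v1].
  - apply: abel_remainder_derive; rewrite subr_gt0.
    have v2 : 0 <= v ^+ 2 <= 1 by rewrite sqr_ge0 expr_le1.
    move: (v ^+ 2) (cos _) c1 v2 => t c c1 /andP[t0 t1].
    have [c0|c0] := leP c 0; first by rewrite (le_lt_trans (mulr_le0_ge0 c0 t0)).
    by rewrite (le_lt_trans _ c1)// ler_piMr// ltW.
  (* The kernel bound assumes v > 0; at v = 0 the derivative vanishes. *)
  - rewrite normrN B'E; move: v0; rewrite le_eqVlt => /predU1P[<-|v0].
      by rewrite exprS !(mul0r, mulr0) normr0 divr_ge0 ?exprn_ge0 ?(ltW s0).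
    exact: sqdist_cis_kernel_le.
rewrite normrM gtr0_norm// => H.
rewrite -(ler_pM2l p0) (le_trans H)// le_eqVlt; apply/orP; left; apply/eqP.
move: (2 * K%:R + 1) K0 (pi : R) p0 (sin _) s0 => n n0 p p0 s s0.
by field; rewrite !gt_eqF.
Qed.

Lemma saw_remainder_sym K x : saw_remainder K (1 - x) = - saw_remainder K x.
Proof.
rewrite /saw_remainder opprD -sumrN; congr (_ + _); first by field.
apply: eq_bigr => k _; rewrite -mulNr -sinN; congr (_ / _).
have -> : 2 * pi * (1 - x) * k%:R = - (2 * pi * x * k%:R) + (pi *+ 2) *+ k.
  by rewrite -[_ *+ 2]mulr_natl -[_ *+ k]mulr_natr; ring.
exact: (periodicn (@sinD2pi R)).
Qed.

Lemma saw_remainder_half K x : 0 < x < 1 -> `|saw_remainder K x| <= 2^-1.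
Proof.
wlog x2 : x / x <= 2^-1.
  move=> H x01; have [|x2] := leP x 2^-1; first by move/H; apply.
  by rewrite -normrN -saw_remainder_sym H//; lra.
move=> x01; have /andP[x0 x1] := x01; have p0 := pi_gt0 R.
have K0 : 0 < (2 * K%:R + 1 : R) by rewrite ltr_wpDl// mulr_ge0.
(* For small x every sine has its argument in [0, pi] and is at most that argument, so the sum lies
   in [0, 2 K x] and the remainder in [-1/2, (2K + 1) x - 1/2]. *)
have [xK|xK] := leP ((2 * K%:R + 1) * x) 1.
  have /andP[S0 S1] : 0 <= \sum_(1 <= k < K.+1) sin (2 * pi * x * k%:R) / (pi * k%:R)
    <= 2 * K%:R * x.
    have -> : 2 * K%:R * x = \sum_(1 <= k < K.+1) 2 * x.
      by rewrite sumr_const_nat subSS subn0 -mulr_natr; ring.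
    have kK k : (1 <= k < K.+1)%N -> 0 < (k%:R : R) /\ (k%:R : R) <= K%:R.
      by rewrite ltr0n ler_nat ltnS => /andP[].
    apply/andP; split.
      rewrite big_nat_cond sumr_ge0// => k /andP[/kK[k0 kK'] _].
      rewrite divr_ge0 ?mulr_ge0 ?(ltW p0) ?(ltW k0)//.
      apply: sin_ge0_pi; rewrite !mulr_ge0 ?(ltW p0) ?(ltW x0) ?(ltW k0)//=.
      rewrite (_ : _ * _ = pi * (2 * (k%:R * x))); last by ring.
      rewrite -[leRHS]mulr1 ler_pM2l//.
      have : k%:R * x <= K%:R * x by rewrite ler_pM2r.
      by move: xK; rewrite mulrDl -mulrA; lra.
    rewrite big_nat_cond [leRHS]big_nat_cond; apply: ler_sum => k /andP[/kK[k0 _] _].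
    rewrite ler_pdivrMr ?mulr_gt0// (_ : 2 * x * _ = 2 * pi * x * k%:R); last by ring.
    by rewrite sin_le_id// !mulr_ge0 ?(ltW p0) ?(ltW x0) ?(ltW k0).
  rewrite /saw_remainder ler_norml; move: xK S0 S1; rewrite mulrDl mul1r; lra.
apply: le_trans (saw_remainder_le K x01) _.
have s2 : 2 * x <= sin (pi * x) by rewrite sin_ge_2x// ltW.
rewrite lef_pV2 ?posrE ?mulr_gt0 ?sin_gt0_01// -mulrA.
(* Hence (2K + 1) pi sin(pi x) >= 2 (2K + 1) x > 2; the crude bound pi >= 1 is enough. *)
have ps : 2 * x <= pi * sin (pi * x).
  rewrite (le_trans s2)// -[leLHS]mul1r ler_wpM2r ?(ltW (sin_gt0_01 x01))//.
  by rewrite (le_trans _ (pi_ge2 R))// ler1n.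
have : (2 * K%:R + 1) * (2 * x) <= (2 * K%:R + 1) * (pi * sin (pi * x)).
  by rewrite ler_pM2l.
lra.
Qed.

(** * Passage from the unit interval to the real line *)

Lemma fracpart_itv x : x \isn't a Num.int -> 0 < fracpart x < 1.
Proof.
move=> xint; rewrite /fracpart subr_gt0 ltrBlDl -{3}[1]/(1%:~R) -intrD floorD1_gt andbT.
by rewrite lt_neqAle floor_le andbT; apply: contraNneq xint => <-; exact: intr_int.
Qed.

Lemma sin_fracpart x k : sin (2 * pi * x * k%:R) = sin (2 * pi * fracpart x * k%:R).
Proof.
have E y : sin (2 * pi * y * k%:R) = complex.Im (e_ y ^+ k) by rewrite e_X /= mulrA.
by rewrite !E e_fracpart.
Qed.

Lemma E_E K x : E_ K x = if x \is a Num.int then 0 else saw_remainder K (fracpart x).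
Proof.
rewrite /E_ /saw; under eq_bigr do rewrite sin_fracpart; case: ifPn => // xint.
rewrite add0r big1// => k _.
have -> : fracpart x = 0 by rewrite /fracpart; apply/eqP; rewrite subr_eq0 eq_sym -intrEfloor.
by rewrite mulr0 mul0r sin0 mul0r.
Qed.

Lemma dist_int_ge0 x : 0 <= dist_int x.
Proof.
apply: lb_le_inf; first by exists `|x - 0%:~R|, 0.
by move=> _ [n _ <-].
Qed.

Lemma dist_int_le x (n : int) : dist_int x <= `|x - n%:~R|.
Proof.
apply: ge_inf; last by exists n.
by exists 0 => _ [m _ <-].
Qed.

(** Jordan's inequality applies to whichever of [fracpart x] and [1 - fracpart x] is at most 1/2;
    these are the distances to the floor and to the next integer. *)
Lemma dist_int_sin x : x \isn't a Num.int -> 2 * dist_int x <= sin (pi * fracpart x).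
Proof.
move=> /fracpart_itv /andP[y0 y1]; have [y2|y2] := leP (fracpart x) 2^-1.
  apply: le_trans (sin_ge_2x _); last by rewrite ltW.
  by rewrite ler_pM2l// (le_trans (dist_int_le x (Num.floor x)))// ger0_norm// ltW.
have -> : sin (pi * fracpart x) = sin (pi * (1 - fracpart x)).
  by move: (fracpart x) => y; rewrite mulrBr mulr1 sinB sinpi cospi mul0r sub0r mulN1r opprK.
apply: le_trans (sin_ge_2x _); last by lra.
rewrite ler_pM2l// (le_trans (dist_int_le x (Num.floor x + 1)))// distrC intrD.
have -> : (Num.floor x)%:~R + 1%:~R - x = 1 - fracpart x.
  by rewrite /fracpart opprB addrA [1 + _]addrC.
by rewrite ger0_norm// subr_ge0 ltW.
Qed.

(** The bound follows from [saw_remainder_le] and [dist_int_sin] by weakening 2K + 1 to 2K. In the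
    extended reals the second bound is +oo at distance 0. *)
Lemma E_bound K x : (1 <= K)%N ->
  (`|E_ K x|%:E <= Order.min (2^-1)%:E ((4 * pi * K%:R * dist_int x)%:E^-1))%E.
Proof.
move=> K1; have p0 := pi_gt0 R; have K0 : 0 < K%:R :> R by rewrite ltr0n.
have d0 := dist_int_ge0 x; rewrite E_E le_min.
have D0 : 0 <= 4 * pi * K%:R * dist_int x by rewrite !mulr_ge0// ltW.
case: ifPn => xint.
  by rewrite normr0 lee_fin invr_ge0 ler0n /= inve_ge0 lee_fin.
rewrite lee_fin saw_remainder_half ?fracpart_itv//=.
move: D0; rewrite le_eqVlt => /predU1P[<-|D0]; first by rewrite inve0 leey.
rewrite inver gt_eqF// lee_fin (le_trans (saw_remainder_le K (fracpart_itv xint)))//.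
have s0 := sin_gt0_01 (fracpart_itv xint).
rewrite lef_pV2 ?posrE//; last by rewrite !mulr_gt0// ltr_wpDl// mulr_ge0// ltW.
have := dist_int_sin xint; move: (sin _) s0 => s s0 ds.
have H1 : 2 * K%:R * pi * (2 * dist_int x) <= 2 * K%:R * pi * s.
  by rewrite ler_pM2l// !mulr_gt0.
have H2 : 0 <= pi * s by rewrite mulr_ge0 ?ltW.
rewrite !mulrDl !mul1r; move: H1 H2.
rewrite (_ : 2 * K%:R * pi * (2 * dist_int x) = 4 * pi * K%:R * dist_int x); last by ring.
lra.
Qed.

End SawtoothBound.

(** * The formulas for S_K and the bound on E_K *)

Unset Implicit Arguments.
Set Strict Implicit.
Set Printing Implicit Defensive.
Local Close Scope classical_set_scope.
Local Open Scope ring_scope.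

Theorem theorem5 (R : realType) (F : finFieldType) (hq : odd #|F|)
  (g : nat) (hg : (1 <= g)%N)
  (D : {poly F}) (Dmonic : D \is monic) (Dsqf : squarefree D)
  (Ddeg : size D = (2 * g + 1).+1)
  (theta_ : 'I_(2 * g) -> R)
  (* the u_j = q^(-1/2) e(theta_j) are the zeros of L(u, chi_D), listed with
     multiplicity (%= is equality up to a nonzero constant factor) *)
  (zeros : L_poly R D %=
             \prod_(j < 2 * g) ('X - (circle_pt F (theta_ j))%:P))
  (K : nat) (hK : (1 <= K)%N) (theta : R) :
  [/\ S_ D K theta =
        \sum_(j < 2 * g) (- saw (theta - theta_ j) + E_ K (theta - theta_ j)),
      S_ D K theta =
        \sum_(j < 2 * g) \sum_(1 <= k < K.+1)
           sin (2 * pi * (theta - theta_ j) * k%:R) / (pi * k%:R)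
    & forall j : 'I_(2 * g),
        (`|E_ K (theta - theta_ j)|%:E <=
         Order.min (2^-1)%:E
           ((4 * pi * K%:R * dist_int (theta - theta_ j))%:E^-1))%E].
Proof.
have SE := S_formula zeros K theta.
split=> [||j]; [|exact: SE|exact: E_bound].
(* [E_] is [saw] plus the sine sum, so [saw] cancels term by term. *)
by rewrite SE; apply: eq_bigr => j _; rewrite /E_ addKr.
Qed.
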